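(* Let $K$ be a simplicial complex with $m$ vertices and let $(\underline X,\underline A)=\{(X_1,A_1),\ldots,(X_m,A_m)\}$ be a family of CW pairs. For a sequence of positive integers $J=(j_1,\ldots,j_m)$, define a new family of pairs $\overline J(\underline X,\underline A)=(\underline Y,\underline B)$ by $(Y_k,B_k)=(X_k,A_k)^{j_k}$ for $k=1,\ldots,m$. Then the polyhedral products $Z(K;\overline J(\underline X,\underline A))$ and $Z(K(J);(\underline X,\underline A))$ are equal subspaces of $X_1^{j_1}\times X_2^{j_2}\times\cdots\times X_m^{j_m}$.
   Context: Simplicial complexes are finite and abstract; $K$ has vertices $v_1,\ldots,v_m$, each of which is a simplex of $K$. Polyhedral product: $Z(K;(\underline X,\underline A))=\bigcup_{\sigma\in K}D(\sigma)\subseteq\prod_{i=1}^mX_i$, where $D(\sigma)=\prod_{i=1}^mW_i$ with $W_i=X_i$ if $v_i\in\sigma$ and $W_i=A_i$ otherwise. Products of pairs: $(X,A)\times(Y,B)=(X\times Y,\,(X\times B)\cup(A\times Y))$, and $(X,A)^k$ is the $k$-fold iterated product. A minimal non-face of $K$ is a set of vertices that is not a simplex although every proper subset is one. $K(J)$ is the simplicial complex on the $j_1+\cdots+j_m$ vertices $v_{11},\ldots,v_{1j_1},\ldots,v_{m1},\ldots,v_{mj_m}$ whose minimal non-faces are exactly the sets $\{v_{i_1 1},\ldots,v_{i_1 j_{i_1}},\ldots,v_{i_k1},\ldots,v_{i_kj_{i_k}}\}$ with $\{v_{i_1},\ldots,v_{i_k}\}$ a minimal non-face of $K$. Convention: $Z(K(J);(\underline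 X,\underline A))$ denotes the polyhedral product determined by $K(J)$ and the family obtained from $(\underline X,\underline A)$ by repeating each $(X_i,A_i)$ $j_i$ times in sequence, so that the pair at the vertex $v_{it}$ is $(X_i,A_i)$. *)

(* Defs.v *)
From mathcomp Require Import all_boot all_order all_algebra.
From mathcomp Require Import all_classical all_reals all_analysis.

Set Implicit Arguments.
Unset Strict Implicit.
Unset Printing Implicit Defensive.

Import Order.TTheory GRing.Theory Num.Theory.
Import numFieldNormedType.Exports.

Local Open Scope classical_set_scope.
Local Open Scope ring_scope.

(* The empty simplex belongs to every complex. *)
Record simplicial_complex (V : finType) := SimplicialComplex {
  simplices :> {set {set V}};
  simplex0 : finset.set0 \in simplices;
  simplex1 : forall v : V, [set v]%SET \in simplices;
  simplexS : forall s t : {set V},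
    s \in simplices -> t \subset s -> t \in simplices }.

Definition minimal_nonface (V : finType) (K : simplicial_complex V)
    (w : {set V}) : bool :=
  (w \notin simplices K) &&
  [forall s : {set V}, (s \proper w) ==> (s \in simplices K)].

(* The vertex v_{it} is the pair Tagged _ t of type {i : V & 'I_(J i)}, so t
   runs over 0, ..., j_i - 1. *)
Definition expand (V : finType) (J : V -> nat) (w : {set V}) :
    {set {i : V & 'I_(J i)}} :=
  [set v | tag v \in w]%SET.

(* L is K(J); lemmas [exists_K_of_J] and [K_of_J_unique] below show that for
   positive J there is exactly one such complex. *)
Definition is_K_of_J (V : finType) (K : simplicial_complex V) (J : V -> nat)
    (L : simplicial_complex {i : V & 'I_(J i)}) : Prop :=
  forall s : {set {i : V & 'I_(J i)}},
    minimal_nonface L s <->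
    exists2 w : {set V}, minimal_nonface K w & s = expand J w.

Lemma nonface_minimal (V : finType) (K : simplicial_complex V) (s : {set V}) :
  s \notin simplices K -> exists2 w, minimal_nonface K w & w \subset s.
Proof.
have [n] := ubnP #|s|; elim: n s => // n IH s /ltnSE cs sK.
have [/existsP[t /andP[ts tK]]|/existsPn h] :=
  boolP [exists t : {set V}, (t \proper s) && (t \notin simplices K)].
- have [|w wK wt] := IH t _ tK; first exact: leq_trans (proper_card ts) cs.
  by exists w => //; exact: fintype.subset_trans wt (proper_sub ts).
- exists s => //; rewrite /minimal_nonface sK /=; apply/forallP => t.
  by apply/implyP => ts; have := h t; rewrite ts /= negbK.
Qed.

Section K_of_J.
Variables (V : finType) (K : simplicial_complex V) (J : V -> nat).
Hypothesis J_gt0 : forall i, (0 < J i)%N.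
Let W : finType := {i : V & 'I_(J i)}.

Let expandS (w w' : {set V}) : expand J w \subset expand J w' -> w \subset w'.
Proof.
move=> /fintype.subsetP h; apply/fintype.subsetP => i iw.
by have := h (Tagged (fun i => 'I_(J i)) (Ordinal (J_gt0 i)));
  rewrite !inE; apply.
Qed.

Let faces : {set {set W}} :=
  [set s : {set W} | [forall w : {set V}, minimal_nonface K w ==>
                                ~~ (expand J w \subset s)]]%SET.

Let facesP (s : {set W}) :
  reflect (forall w, minimal_nonface K w -> ~~ (expand J w \subset s))
          (s \in faces).
Proof. by rewrite inE; apply: (iffP forallP) => h w; apply/implyP/h. Qed.

Let face1 (v : W) : [set v]%SET \in faces.
Proof.
apply/facesP => w /andP[wK _]; apply/negP => /fintype.subsetP h.
suff : w \in simplices K by rewrite (negbTE wK).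
apply: simplexS (simplex1 K (tag v)) _; apply/fintype.subsetP => i iw.
have := h (Tagged (fun i => 'I_(J i)) (Ordinal (J_gt0 i))).
by rewrite !inE => /(_ iw) /eqP <-.
Qed.

Let faceS (s t : {set W}) : s \in faces -> t \subset s -> t \in faces.
Proof.
move=> /facesP h ts; apply/facesP => w wK; apply: contra (h _ wK) => wt.
exact: fintype.subset_trans wt ts.
Qed.

Let face0 : finset.set0 \in faces.
Proof.
apply/facesP => w /andP[wK _]; apply/negP => /fintype.subsetP h.
suff : w \in simplices K by rewrite (negbTE wK).
apply: simplexS (simplex0 K) _; apply/fintype.subsetP => i iw.
by have := h (Tagged (fun i => 'I_(J i)) (Ordinal (J_gt0 i)));
  rewrite !inE => /(_ iw).
Qed.

Lemma exists_K_of_J : exists L : simplicial_complex W, is_K_of_J K L.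
Proof.
exists (SimplicialComplex face0 face1 faceS) => s; split.
- move=> /andP[/= sL /forallP sP]; have : s \notin faces by [].
  rewrite inE negb_forall => /existsP[w].
  rewrite negb_imply negbK => /andP[wK ws]; exists w => //.
  apply/eqP; rewrite finset.eqEsubset ws andbT; apply: contraT => sw.
  have /implyP/(_ _)/facesP/(_ _ wK) := sP (expand J w).
  by rewrite fintype.subxx => /(_ _)/negP []//; rewrite properE ws.
- move=> [w wK ->]; apply/andP; split => /=.
    by apply/negP => /facesP/(_ _ wK); rewrite fintype.subxx.
  apply/forallP => t; apply/implyP => tw; apply/facesP => w' w'K.
  apply/negP => w't; have w'w := sub_proper_trans w't tw.
  have /andP[_ /forallP/(_ w')] := wK.
  have /andP[/negbTE -> _] := w'K; rewrite implybF => /negP; apply.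
  rewrite properE (expandS (proper_sub w'w)) /=.
  move: w'w; rewrite properE => /andP[_]; apply: contra => /fintype.subsetP h.
  by apply/fintype.subsetP => v; rewrite !inE; apply: h.
Qed.

Lemma K_of_J_unique (L L' : simplicial_complex W) :
  is_K_of_J K L -> is_K_of_J K L' -> simplices L = simplices L'.
Proof.
have sub (L1 L2 : simplicial_complex W) : is_K_of_J K L1 -> is_K_of_J K L2 ->
    simplices L1 \subset simplices L2.
  move=> h1 h2; apply/fintype.subsetP => s sL; apply: contraT.
  move=> /nonface_minimal[w /h2/h1/andP[/negP wL _] ws].
  by case: wL; exact: simplexS sL ws.
by move=> h h'; apply/eqP; rewrite finset.eqEsubset !sub.
Qed.

End K_of_J.

Record top_pair := TopPair { space :> topologicalType; subsp : set space }.

(* The product of spaces carries the ordinary product topology. *)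
Definition prod_pair (P Q : top_pair) : top_pair :=
  TopPair ((@setT P `*` @subsp Q) `|` (@subsp P `*` @setT Q)).

(* pow_pairS P n is (X, A)^(n + 1), with (X, A)^(n + 1) = (X, A)^n x (X, A). *)
Fixpoint pow_pairS (P : top_pair) (n : nat) : top_pair :=
  if n is n'.+1 then prod_pair (pow_pairS P n') P else P.

(* Only meaningful for 0 < k: the 0-fold power is (X, A) here. *)
Definition pow_pair (P : top_pair) (k : nat) : top_pair := pow_pairS P k.-1.

(* The coordinate of index t <= n of a point of X^(n + 1). *)
Fixpoint coordS (P : top_pair) (n t : nat) : pow_pairS P n -> P :=
  match n return pow_pairS P n -> P with
  | 0%N => fun x => x
  | n'.+1 => fun x => if t == n'.+1 then x.2 else @coordS P n' t x.1
  end.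

Definition coord (P : top_pair) (k t : nat) : pow_pair P k -> P :=
  @coordS P k.-1 t.

Definition polyD (V : finType) (P : V -> top_pair) (s : {set V}) :
    set (prod_topology P) :=
  [set x | forall v, (if v \in s then setT else @subsp (P v)) (x v)].
Arguments polyD {V} P s.

(* Z(K; (X, A)), as a subset of the product of the X_v. *)
Definition polyhedral_product (V : finType) (K : simplicial_complex V)
    (P : V -> top_pair) : set (prod_topology P) :=
  \bigcup_(s in [set` simplices K]) polyD P s.
Arguments polyhedral_product {V} K P.

(* The identification of X_1^{j_1} x ... x X_m^{j_m}, in which each X_i^{j_i}
   is an iterated binary product, with the product of the X_i over all the
   v_{it}. *)
Definition flatten_prod (V : finType) (P : V -> top_pair) (J : V -> nat)
    (y : prod_topology (fun i : V => pow_pair (P i) (J i))) :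
    prod_topology (fun v : {i : V & 'I_(J i)} => P (tag v)) :=
  fun v => coord (tagged v) (y (tag v)).
Arguments flatten_prod {V} P J y.

Definition homeomorphism (S T : topologicalType) (f : S -> T) : Prop :=
  exists g : T -> S, [/\ cancel f g, cancel g f, continuous f & continuous g].

Section Disk.
Variable R : realType.

Definition sqnorm (n : nat) (x : 'rV[R]_n) : R := \sum_(i < n) x ord0 i ^+ 2.
Definition disk (n : nat) : set 'rV[R]_n := [set x | sqnorm x <= 1].
Definition open_disk (n : nat) : set 'rV[R]_n := [set x | sqnorm x < 1].
Definition sphere (n : nat) : set 'rV[R]_n := [set x | sqnorm x = 1].

End Disk.

(* A CW structure on X, given by its characteristic maps: they are continuous
   on the closed disks and restrict to homeomorphisms from the open disks onto
   disjoint cells that cover X, boundaries are covered by finitely many cells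
   of smaller dimension, and X has the weak topology.  The values of charmap
   outside of the disk are irrelevant. *)
Record CW_structure (R : realType) (X : topologicalType) := CWStructure {
  cell : Type;
  cell_dim : cell -> nat;
  charmap : forall e : cell, 'rV[R]_(cell_dim e) -> X;
  open_cell := fun e : cell => charmap (e := e) @` @open_disk R (cell_dim e);
  CW_hausdorff : hausdorff_space X;
  CW_continuous : forall e : cell,
    {within @disk R (cell_dim e), continuous (charmap (e := e))};
  CW_homeo : forall e : cell, exists2 g : X -> 'rV[R]_(cell_dim e),
    {within open_cell e, continuous g} &
    forall x, @open_disk R (cell_dim e) x -> g (charmap x) = x;
  CW_disjoint : trivIset setT open_cell;
  CW_cover : \bigcup_e open_cell e = setT;
  CW_boundary : forall e : cell, exists F : set cell,
    [/\ finite_set F,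
        forall f, F f -> (cell_dim f < cell_dim e)%N &
        charmap (e := e) @` @sphere R (cell_dim e)
          `<=` \bigcup_(f in F) open_cell f];
  CW_weak : forall C : set X,
    closed C <-> forall e : cell, closed (C `&` closure (open_cell e)) }.

(* A subcomplex is a union of cells that contains the closure of each of
   them. *)
Definition CW_pair (R : realType) (P : top_pair) : Prop :=
  exists (S : CW_structure R P) (E : set (cell S)),
    @subsp P = \bigcup_(e in E) open_cell e /\
    forall e, E e -> closure (open_cell e) `<=` @subsp P.

(* Main.v *)
Require Import Defs.
From mathcomp Require Import all_boot all_order all_algebra.
From mathcomp Require Import all_classical all_reals all_analysis.

Local Open Scope classical_set_scope.

(* A point x lies in Z(L; (X, A)) iff its support {v | x_v notin A_v} is a
   simplex of L.  A coordinate y_i of X_i^{j_i} lies outside of B_i iff all of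
   its j_i coordinates lie outside of A_i, so the support of y is
   {i | v_{i1}, ..., v_{ij_i} are all in s}, where s is the support of the
   flattened point; and s contains a minimal non-face of K(J) iff this set
   contains a minimal non-face of K. *)

Section SupportCriterion.
Context {V : finType}.

Definition support_off (P : V -> top_pair) (x : prod_topology P) : {set V} :=
  [set v | ~~ `[< subsp (x v) >]]%SET.

(** [polyD P s] contains [x] exactly when [s] contains the support of [x]. The support is thus the
    least candidate for [s], and simplices are closed under passing to subsets. *)
Lemma polyhedral_productE (K : simplicial_complex V) (P : V -> top_pair)
    (x : prod_topology P) :
  polyhedral_product K P x <-> support_off P x \in simplices K.
Proof.
split=> [[s /= sK xs] | xK].
  apply: simplexS sK _; apply/fintype.subsetP => v.
  rewrite inE => /asboolPn xv; have := xs v; case: ifP => // _ /xv [].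
exists (support_off P x) => //= v; rewrite inE.
by case: ifPn => //; rewrite negbK => /asboolP.
Qed.

Variables (K : simplicial_complex V) (J : V -> nat).

Definition full_blocks (s : {set {i : V & 'I_(J i)}}) : {set V} :=
  [set i | [forall t : 'I_(J i), Tagged (fun i => 'I_(J i)) t \in s]]%SET.

(** A Galois connection: [full_blocks] is right adjoint to [expand], which lets non-faces be moved
    between [K] and K(J). *)
Lemma expand_subset (w : {set V}) (s : {set {i : V & 'I_(J i)}}) :
  (Defs.expand J w \subset s) = (w \subset full_blocks s).
Proof.
apply/fintype.subsetP/fintype.subsetP => h i.
  by move=> iw; rewrite inE; apply/forallP => t; apply: h; rewrite inE.
by case: i => i t; rewrite inE => /h; rewrite inE => /forallP/(_ t).
Qed.

(** Being a non-face means containing a minimal one. Those of [L] are the sets [expand J w], and the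
    adjunction turns their inclusion in [s] into that of [w] in [full_blocks s]. *)
Lemma K_of_J_simplexE (L : simplicial_complex {i : V & 'I_(J i)}) s :
  is_K_of_J K L -> (s \in simplices L) = (full_blocks s \in simplices K).
Proof.
move=> hL; apply/idP/idP; apply: contraTT => /nonface_minimal[w].
  move=> wK; rewrite -expand_subset => ws; have /hL /andP[wL _] :
    exists2 w', minimal_nonface K w' & Defs.expand J w = Defs.expand J w'.
      by exists w.
  by apply: contra wL => sL; apply: simplexS sL ws.
move=> /hL[w' /andP[w'K _] ->]; rewrite expand_subset => w's.
by apply: contra w'K => sK; apply: simplexS sK w's.
Qed.

End SupportCriterion.

Section IteratedPower.
Variable P : top_pair.

(** By induction: the distinguished subspace of a product of pairs asks for at least one component
    in its own subspace. *)
Lemma subsp_pow_pairS n (x : pow_pairS P n) :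
  subsp x <-> exists2 t, (t <= n)%N & subsp (coordS t x).
Proof.
elim: n x => [|n IH] /= x; first by split=> [|[]] //; exists 0%N.
split=> [[[_ xA]|[/IH[t tn xA] _]] | [t]].
- by exists n.+1; rewrite ?eqxx.
- by exists t; rewrite ?ltn_eqF ?(leqW tn).
- rewrite leq_eqVlt; case: eqVneq => [_ _ xA|_ /= tn xA]; first by left.
  by right; split=> //; apply/IH; exists t.
Qed.

(** Inverse to taking coordinates. With [f] defined on all of [nat], the recursion needs no change
    of index type; only the values at 0, ..., [n] are read. *)
Fixpoint assemble n (f : nat -> P) : pow_pairS P n :=
  match n return pow_pairS P n with
  | 0%N => f 0%N
  | n'.+1 => (assemble n' f, f n'.+1)
  end.

Lemma coordS_assemble n f t : (t <= n)%N -> coordS t (assemble n f) = f t.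
Proof.
elim: n => [|n IH] /=; first by rewrite leqn0 => /eqP ->.
by rewrite leq_eqVlt; case: eqVneq => [->|_ /IH].
Qed.

Lemma eq_assemble n f g :
  (forall t, (t <= n)%N -> f t = g t) -> assemble n f = assemble n g.
Proof.
elim: n => [|n IH] /= fg; first exact: fg.
by rewrite fg ?IH // => t tn; apply: fg; apply: leqW.
Qed.

Lemma assemble_coordS n (x : pow_pairS P n) :
  assemble n (fun t => coordS t x) = x.
Proof.
elim: n x => //= n IH [x1 x2] /=; rewrite eqxx; congr pair.
(* An index [t <= n] differs from the top index [n.+1], so [coordS] reads it from the first
   component. *)
rewrite -[RHS]IH; apply: eq_assemble => t tn.
by rewrite ltn_eqF.
Qed.

Lemma coordS_continuous n t : continuous (@coordS P n t).
Proof.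
elim: n => [|n IH] /= x; first exact: cvg_id.
case: eqVneq => _; first exact: cvg_snd.
by apply: (@cvg_comp _ _ _ fst (@coordS P n t)); [exact: cvg_fst|exact: IH].
Qed.

Lemma assemble_continuous {S : topologicalType} n (f : S -> nat -> P) :
  (forall t, continuous (fun x => f x t)) ->
  continuous (fun x => assemble n (f x)).
Proof.
move=> cf; elim: n => [|n IH] /= x; first exact: cf.
by apply: cvg_pair; [exact: IH|exact: cf].
Qed.

End IteratedPower.

Lemma continuous_prod_topology {S : topologicalType} {I : Type}
    {T : I -> topologicalType} (f : S -> prod_topology T) :
  (forall i, continuous (fun x => f x i)) -> continuous f.
Proof.
(* The product topology is the supremum of the topologies induced by the projections, so only
   preimages of open sets [B] of one factor need checking. *)
move=> cf x; apply/cvg_sup => i U [_ [[B oB <-] Bfx] /filterS]; apply.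
by apply: cf; exact: open_nbhs_nbhs.
Qed.

Section Flatten.
Context {V : finType} (P : V -> top_pair) (J : V -> nat).
Hypothesis J_gt0 : forall i, (0 < J i)%N.

(* Indices t >= J i are never read; they are sent to 0. *)
Definition unflatten_prod
    (z : prod_topology (fun v : {i : V & 'I_(J i)} => P (tag v))) :
    prod_topology (fun i : V => pow_pair (P i) (J i)) :=
  fun i => assemble (P i) (J i).-1
    (fun t => z (Tagged (fun i => 'I_(J i)) (insubd (Ordinal (J_gt0 i)) t))).

Lemma leq_predJ i t : (t <= (J i).-1)%N = (t < J i)%N.
Proof. by rewrite -ltnS prednK. Qed.

Lemma flatten_prodK : cancel (flatten_prod P J) unflatten_prod.
Proof.
move=> y; apply: functional_extensionality_dep => i.
rewrite -[RHS]assemble_coordS; apply: eq_assemble => t; rewrite leq_predJ => tJ.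
by rewrite /flatten_prod /= insubdK.
Qed.

Lemma unflatten_prodK : cancel unflatten_prod (flatten_prod P J).
Proof.
move=> z; apply: functional_extensionality_dep => -[i t].
(* Since [t] is an ordinal below [J i], [insubd] returns [t] itself and never its default. *)
by rewrite /flatten_prod /Defs.coord /= coordS_assemble ?leq_predJ // valKd.
Qed.

Lemma flatten_prod_continuous : continuous (flatten_prod P J).
Proof.
apply: continuous_prod_topology => -[i t] y.
apply: (@cvg_comp _ _ _ (fun y : prod_topology _ => y i) (@Defs.coord _ _ t)).
  exact: (@proj_continuous V (fun i => pow_pair (P i) (J i)) i).
exact: coordS_continuous.
Qed.

Lemma unflatten_prod_continuous : continuous unflatten_prod.
Proof.
apply: continuous_prod_topology => i; apply: assemble_continuous => t z.
exact: (@proj_continuous {i : V & 'I_(J i)} (fun v => P (tag v))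
  (Tagged (fun i => 'I_(J i)) (insubd (Ordinal (J_gt0 i)) t)) z).
Qed.

Lemma support_off_flatten (y : prod_topology (fun i => pow_pair (P i) (J i))) :
  full_blocks J (support_off (fun v => P (tag v)) (flatten_prod P J y)) =
  support_off (fun i => pow_pair (P i) (J i)) y.
Proof.
apply/setP => i; rewrite !inE; apply/forallP/asboolPn => [h|h t].
  move=> /subsp_pow_pairS[t]; rewrite leq_predJ => tJ yt.
  by have := h (Ordinal tJ); rewrite inE => /asboolPn.
rewrite inE; apply/asboolPn => yt; apply: h; apply/subsp_pow_pairS.
by exists (val t) => //; rewrite leq_predJ ltn_ord.
Qed.

End Flatten.

Theorem theorem7p2 (R : realType) (m : nat) (K : simplicial_complex 'I_m)
    (XA : 'I_m -> top_pair) (hXA : forall i : 'I_m, CW_pair R (XA i))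
    (J : 'I_m -> nat) (hJ : forall i : 'I_m, (0 < J i)%N)
    (KJ : simplicial_complex {i : 'I_m & 'I_(J i)}) (hKJ : is_K_of_J K KJ) :
  homeomorphism (flatten_prod XA J) /\
  flatten_prod XA J @`
    polyhedral_product K (fun i : 'I_m => pow_pair (XA i) (J i)) =
  polyhedral_product KJ
    (fun v : {i : 'I_m & 'I_(J i)} => XA (tag v)).
Proof.
have memE y : polyhedral_product KJ (fun v => XA (tag v)) (flatten_prod XA J y)
    <-> polyhedral_product K (fun i => pow_pair (XA i) (J i)) y.
  by rewrite !polyhedral_productE (K_of_J_simplexE _ _ _ _ hKJ)
    support_off_flatten.
split.
  exists (unflatten_prod XA J hJ); split.
  - exact: flatten_prodK.
  - exact: unflatten_prodK.
  - exact: flatten_prod_continuous.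
  - exact: unflatten_prod_continuous.
apply/seteqP; split=> [_ [y /memE yK <-] //|z].
(* Every [z] is a flattened point, so [memE] also decides the membership of [z]. *)
rewrite -[z](unflatten_prodK XA J hJ) => /memE zK.
by exists (unflatten_prod XA J hJ z).
Qed.
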